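(* Let $A\in\mathbb{C}^{n\times n}$ be a non-singular and non-defective matrix, let $P\in\mathbb{R}^{m\times n}$, $P'\in\mathbb{R}^{n\times m}$ be the inter-grid transfer operators, let $A_c=PAP'$ be non-singular, and let $X=\omega\Lambda_A$ be the (non-singular) $\omega$-Jacobi smoother. Let the two-grid operator be $$T_0=\left(I-P'A_c^{-1}PA\right)\left(I-X^{-1}A\right),$$ let $$D=X^{-1}+P'A_c^{-1}P-P'A_c^{-1}PAX^{-1},$$ and let $$\Gamma=A^{H}D^{H}+DA-A^{H}D^{H}DA.$$ Then $T_0^{H}T_0=I-\Gamma$. Moreover, if $\Gamma$ is positive definite, then every eigenvalue of $\Gamma$ satisfies $\lambda_j(\Gamma)\in(0,2)$, and $\|T_0\|_2<1$, independent of $h$ (that is, the implication holds whatever the grid size $h$, equivalently whatever the dimensions $n$ and $m$).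
   Context: $B^{H}$ denotes the conjugate transpose of $B$, $I$ is the $n\times n$ identity, and $\|\cdot\|_2$ is the spectral norm on $\mathbb{C}^{n\times n}$. $\Lambda_A$ is the diagonal matrix containing the diagonal entries of $A$, and $\omega>0$ is a relaxation parameter; $X=\omega\Lambda_A$ is assumed invertible, i.e. all diagonal entries of $A$ are nonzero. $P$ maps fine-grid vectors (in $\mathbb{C}^n$) to coarse-grid vectors (in $\mathbb{C}^m$), $P'$ maps coarse-grid vectors to fine-grid vectors, and $A_c=PAP'\in\mathbb{C}^{m\times m}$ is the Galerkin coarse-grid matrix, assumed invertible. A matrix is non-defective if it is diagonalizable. A matrix $B\in\mathbb{C}^{n\times n}$ is positive definite if $x^{H}Bx>0$ for all $x\in\mathbb{C}^{n}\setminus\{0\}$. The parameter $h$ is the mesh size of the discretization from which $A$ arises. *)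

(* Defs.v *)
From HB Require Import structures.
From mathcomp Require Import all_boot all_order all_algebra.
From mathcomp Require Export complex.
From mathcomp Require Import classical_sets reals.

Set Implicit Arguments.
Unset Strict Implicit.
Unset Printing Implicit Defensive.

Import Order.TTheory GRing.Theory Num.Theory.

Local Open Scope sesquilinear_scope.
Local Open Scope classical_set_scope.
Local Open Scope ring_scope.

(* The order of R[i] is partial: 0 < z means that z is real and positive, so
   Hermitian symmetry of B follows from this definition. *)
Definition posdef (R : realType) (n : nat) (B : 'M[R[i]]_n) : Prop :=
  forall x : 'cV[R[i]]_n, x != 0 -> 0 < (x ^t* *m B *m x) 0 0.

Definition l2norm (R : realType) (n : nat) (x : 'cV[R[i]]_n) : R :=
  Num.sqrt (\sum_(i < n) ComplexField.Normc.normc (x i 0) ^+ 2).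

(* The operator norm induced by l2norm; the closed unit ball, rather than the
   unit sphere, keeps the set nonempty when n = 0. *)
Definition spectral_norm (R : realType) (n : nat) (B : 'M[R[i]]_n) : R :=
  sup [set l2norm (B *m x) | x in [set x : 'cV[R[i]]_n | l2norm x <= 1]].

Definition jacobi (R : realType) (n : nat) (w : R) (A : 'M[R[i]]_n)
  : 'M[R[i]]_n := real_complex R w *: diag_mx (\row_(i < n) A i i).

Section TwoGrid.
Variables (R : realType) (n m : nat).
Variables (A : 'M[R[i]]_n) (P : 'M[R[i]]_(m, n)) (P' : 'M[R[i]]_(n, m)).
Variable X : 'M[R[i]]_n.

Definition coarse_mx : 'M[R[i]]_m := P *m A *m P'.

Definition two_grid : 'M[R[i]]_n :=
  (1%:M - P' *m invmx coarse_mx *m P *m A) *m (1%:M - invmx X *m A).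

Definition D_mx : 'M[R[i]]_n :=
  invmx X + P' *m invmx coarse_mx *m P
  - P' *m invmx coarse_mx *m P *m A *m invmx X.

Definition Gamma_mx : 'M[R[i]]_n :=
  A ^t* *m D_mx ^t* + D_mx *m A - A ^t* *m D_mx ^t* *m D_mx *m A.

End TwoGrid.

(* Main.v *)
(* Expanding the product gives T0 = I - D A, hence T0^H T0 = I - Gamma; so Gamma
   is Hermitian and Gamma <= I as a quadratic form, which bounds its eigenvalues
   by 1. The spectral theorem diagonalizes Gamma unitarily, so if Gamma is
   positive definite then x^H Gamma x >= c |x|^2, where c > 0 is the minimum of
   its eigenvalues, capped at 1. Thus |T0 x|^2 <= (1 - c) |x|^2, and
   |T0|_2 <= sqrt (1 - c) < 1. *)
Require Import Defs.
From HB Require Import structures.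
From mathcomp Require Import all_boot all_order all_algebra.
From mathcomp Require Import classical_sets reals.

Set Implicit Arguments.
Unset Strict Implicit.
Unset Printing Implicit Defensive.

Import Order.TTheory GRing.Theory Num.Theory.

Local Open Scope sesquilinear_scope.
Local Open Scope ring_scope.

Section QuadraticForms.
Variable C : numClosedFieldType.

Lemma trmxC_mul m n p (A : 'M[C]_(m, n)) (B : 'M[C]_(n, p)) :
  (A *m B) ^t* = B ^t* *m A ^t*.
Proof. by rewrite trmx_mul map_mxM. Qed.

Lemma trmxCB m n (A B : 'M[C]_(m, n)) : (A - B) ^t* = A ^t* - B ^t*.
Proof. by rewrite linearB map_mxB. Qed.

Lemma trmxC1 n : (1%:M : 'M[C]_n) ^t* = 1%:M.
Proof. by rewrite trmx1 map_mx1. Qed.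

Lemma diag_quad_form n (d : 'rV[C]_n) (x : 'cV[C]_n) :
  (x ^t* *m diag_mx d *m x) 0 0 = \sum_i d 0 i * `|x i 0| ^+ 2.
Proof.
rewrite mul_mx_diag mxE; apply: eq_bigr => i _.
by rewrite !mxE normCK [RHS]mulrCA mulrC [d 0 i * _]mulrC.
Qed.

Lemma dot_sum_sqr_norm n (x : 'cV[C]_n) :
  (x ^t* *m x) 0 0 = \sum_i `|x i 0| ^+ 2.
Proof. by rewrite mxE; apply: eq_bigr => i _; rewrite !mxE normCK mulrC. Qed.

Lemma dot_ge0 n (x : 'cV[C]_n) : 0 <= (x ^t* *m x) 0 0.
Proof. by rewrite dot_sum_sqr_norm sumr_ge0 // => i _; rewrite exprn_ge0. Qed.

Lemma dot_gt0 n (x : 'cV[C]_n) : x != 0 -> 0 < (x ^t* *m x) 0 0.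
Proof.
move=> x0; rewrite lt_def dot_ge0 andbT; apply: contra_neq x0.
rewrite dot_sum_sqr_norm => /eqP; rewrite psumr_eq0 => [/allP x0|i _]; last first.
  by rewrite exprn_ge0.
apply/colP => i; apply/eqP; rewrite mxE -normr_eq0 -sqrf_eq0.
exact: (x0 i (mem_index_enum i)).
Qed.

End QuadraticForms.

Lemma hermitian_spectral_decomp (C : numClosedFieldType) n (B : 'M[C]_n) :
  B ^t* = B -> B = spectralmx B ^t* *m diag_mx (spectral_diag B) *m spectralmx B.
Proof.
move=> hB; rewrite -invmx_unitary ?spectral_unitarymx //.
by apply/orthomx_spectralP/normalmxP; rewrite hB.
Qed.

Section Coercivity.
Variable R : realType.

(** Bridge between real norms and complex quadratic forms: estimates obtained in [R[i]] are read
    back in [R] through it. *)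
Lemma sqr_l2norm n (x : 'cV[R[i]]_n) :
  real_complex R (l2norm x ^+ 2) = (x ^t* *m x) 0 0.
Proof.
rewrite dot_sum_sqr_norm sqr_sqrtr; last by apply: sumr_ge0 => i _; exact: sqr_ge0.
by rewrite rmorph_sum; apply: eq_bigr => i _; rewrite rmorphXn.
Qed.

Lemma l2norm_ge0 n (x : 'cV[R[i]]_n) : 0 <= l2norm x.
Proof. exact: sqrtr_ge0. Qed.

Lemma l2norm0 n : l2norm (0 : 'cV[R[i]]_n) = 0.
Proof.
rewrite /l2norm big1 ?sqrtr0 // => i _.
by rewrite mxE ComplexField.Normc.normc0 expr0n.
Qed.

(** With U the unitary [spectralmx B], the vector U^H e_j is a unit eigenvector, and the form of [B]
    takes the j-th eigenvalue as its value there. *)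
Lemma posdef_spectral_diag_gt0 n (B : 'M[R[i]]_n) (j : 'I_n) :
  B ^t* = B -> posdef B -> 0 < spectral_diag B 0 j.
Proof.
move=> hB pB; have U1 : spectralmx B *m spectralmx B ^t* = 1%:M.
  exact/unitarymxP/spectral_unitarymx.
have UK (x : 'cV[R[i]]_n) : spectralmx B *m (spectralmx B ^t* *m x) = x.
  by rewrite mulmxA U1 mul1mx.
have ej0 : spectralmx B ^t* *m delta_mx j 0 != 0 :> 'cV[R[i]]_n.
  apply/negP => /eqP /(congr1 (mulmx (spectralmx B))); rewrite UK mulmx0.
  by move=> /matrixP/(_ j 0)/eqP; rewrite !mxE !eqxx oner_eq0.
have := pB _ ej0; rewrite [X in _ *m X *m _]hermitian_spectral_decomp //.
rewrite trmxC_mul trmxCK -!mulmxA !UK mulmxA diag_quad_form (bigD1 j) //= big1 => [|i ij].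
  by rewrite mxE !eqxx normr1 expr1n mulr1 addr0.
by rewrite mxE (negPf ij) normr0 expr0n mulr0.
Qed.

Lemma posdef_coercive n (B : 'M[R[i]]_n) : B ^t* = B -> posdef B ->
  exists2 c : R, 0 < c <= 1 & forall x : 'cV[R[i]]_n,
    real_complex R c * (x ^t* *m x) 0 0 <= (x ^t* *m B *m x) 0 0.
Proof.
(* Positive elements of [R[i]] are real, so passing to real parts loses nothing and a minimum can be
   taken in the total order of [R]. *)
move=> hB pB; pose d i := complex.Re (spectral_diag B 0 i).
have dE i : spectral_diag B 0 i = real_complex R (d i).
  by rewrite /d RRe_real // gtr0_real // posdef_spectral_diag_gt0.
have d0 i : 0 < d i by rewrite -(ltcR 0) -dE posdef_spectral_diag_gt0.
(* The default value 1 serves as the cap, and also covers n = 0, where there are no eigenvalues. *)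
exists (\big[Num.min/1]_i d i).
  by rewrite bigmin_le_id andbT; apply: lt_bigmin => // i _; exact: d0.
(* This unitary change of variable preserves the norm and makes the form diagonal, so the bound is
   checked term by term. *)
move=> x; pose y := spectralmx B *m x.
have -> : (x ^t* *m x) 0 0 = (y ^t* *m y) 0 0.
  rewrite trmxC_mul mulmxA -(mulmxA (x ^t*)) -invmx_unitary.
    by rewrite mulVmx ?spectral_unit // mulmx1.
  exact: spectral_unitarymx.
have -> : (x ^t* *m B *m x) 0 0 = (y ^t* *m diag_mx (spectral_diag B) *m y) 0 0.
  by rewrite [in LHS](hermitian_spectral_decomp hB) trmxC_mul !mulmxA.
rewrite diag_quad_form dot_sum_sqr_norm mulr_sumr; apply: ler_sum => i _.
by rewrite ler_wpM2r ?exprn_ge0 // dE lecR bigmin_le_cond.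
Qed.

(* Positivity alone gives |T x| < |x| for each x; the supremum over the ball is
   below 1 because of the uniform gap supplied by coercivity. *)
Lemma spectral_norm_lt1 n (T : 'M[R[i]]_n) :
  posdef (1%:M - T ^t* *m T) -> spectral_norm T < 1.
Proof.
move=> pT; have hT : (1%:M - T ^t* *m T) ^t* = 1%:M - T ^t* *m T.
  by rewrite trmxCB trmxC1 trmxC_mul trmxCK.
have [c /andP[c0 c1] cT] := posdef_coercive hT pT.
have q1 : Num.sqrt (1 - c) < 1 by rewrite -[ltRHS]sqrtr1 ltr_sqrt // gtrBl.
apply: le_lt_trans q1; apply: ge_sup => [|_ [x /= x1 <-]].
  by exists (l2norm (T *m 0)), 0; rewrite //= l2norm0 ler01.
rewrite -(ler_sqr (l2norm_ge0 _) (sqrtr_ge0 _)) [leRHS]sqr_sqrtr ?subr_ge0 //.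
(* Coercivity reads c |x|^2 <= |x|^2 - |T x|^2. *)
have le_c : l2norm (T *m x) ^+ 2 <= (1 - c) * l2norm x ^+ 2.
  have := cT x; rewrite mulmxBr mulmx1 mulmxBl [leRHS]mxE [X in _ <= _ + X]mxE.
  rewrite !mulmxA -trmxC_mul -mulmxA -!sqr_l2norm -rmorphM -rmorphB lecR.
  by rewrite mulrBl mul1r lerBrDr -lerBrDl.
apply: le_trans le_c _; rewrite ler_piMr ?subr_ge0 //.
by rewrite expr_le1 ?l2norm_ge0.
Qed.

End Coercivity.

(** Eigenvectors here are rows v with v B = a v. Taking x = v^H gives x^H B = a x^H, so [a] appears
    unconjugated even for non-Hermitian [B]. *)
Lemma eigenvalue_quad_form (C : numClosedFieldType) n (B : 'M[C]_n) a :
  eigenvalue B a -> exists2 x : 'cV[C]_n, x != 0 &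
    (x ^t* *m B *m x) 0 0 = a * (x ^t* *m x) 0 0.
Proof.
move=> /eigenvalueP[v vB v0]; exists (v ^t*).
  by apply: contra_neq v0 => v0; rewrite -[v]trmxCK v0 trmx0 map_mx0.
by rewrite trmxCK vB -scalemxAl mxE.
Qed.

Lemma eigenvalue_posdef_compl_gram (R : realType) n (T : 'M[R[i]]_n) a :
  posdef (1%:M - T ^t* *m T) -> eigenvalue (1%:M - T ^t* *m T) a -> 0 < a <= 1.
Proof.
move=> pT /eigenvalue_quad_form[x x0 xE]; have xx0 := dot_gt0 x0.
(* Both bounds are multiplied by |x|^2 > 0; the upper one becomes |x|^2 - |T x|^2 <= |x|^2. *)
rewrite -(pmulr_lgt0 _ xx0) -xE pT //= -(ler_pM2r xx0) -xE mul1r.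
rewrite mulmxBr mulmx1 mulmxBl mxE [X in _ + X <= _]mxE !mulmxA -trmxC_mul -mulmxA.
by rewrite gerBl dot_ge0.
Qed.

Lemma two_gridE (R : realType) n m (A X : 'M[R[i]]_n) (P : 'M[R[i]]_(m, n))
    (P' : 'M[R[i]]_(n, m)) :
  two_grid A P P' X = 1%:M - D_mx A P P' X *m A.
Proof.
rewrite /two_grid /D_mx mulmxBr mulmx1 mulmxBl mul1mx mulmxBl mulmxDl !mulmxA.
by rewrite -addrA -opprD addrA [invmx X *m A + _]addrC.
Qed.

Lemma gram_two_gridE (R : realType) n m (A X : 'M[R[i]]_n)
    (P : 'M[R[i]]_(m, n)) (P' : 'M[R[i]]_(n, m)) :
  two_grid A P P' X ^t* *m two_grid A P P' X = 1%:M - Gamma_mx A P P' X.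
Proof.
rewrite two_gridE /Gamma_mx trmxCB trmxC1 trmxC_mul mulmxBr mulmx1 mulmxBl mul1mx.
by rewrite !mulmxA -addrA -opprD addrA.
Qed.

Theorem theorem3p2 (R : realType) (n m : nat) (A : 'M[R[i]]_n)
    (P : 'M[R]_(m, n)) (P' : 'M[R]_(n, m)) (w : R) :
  let PC := map_mx (real_complex R) P in
  let PC' := map_mx (real_complex R) P' in
  let X := jacobi w A in
  let T0 := two_grid A PC PC' X in
  let Gamma := Gamma_mx A PC PC' X in
  A \in unitmx ->
  diagonalizable A ->
  coarse_mx A PC PC' \in unitmx ->
  0 < w ->
  X \in unitmx ->
  T0 ^t* *m T0 = 1%:M - Gamma /\
  (posdef Gamma ->
    (forall lambda : R[i], eigenvalue Gamma lambda -> 0 < lambda < 2) /\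
    spectral_norm T0 < 1).
Proof.
move=> PC PC' X T0 Gamma _ _ _ _ _.
have GE : T0 ^t* *m T0 = 1%:M - Gamma by exact: gram_two_gridE.
split=> //; have <- : 1%:M - T0 ^t* *m T0 = Gamma by rewrite GE subKr.
move=> pG; split; last exact: spectral_norm_lt1.
move=> a /(eigenvalue_posdef_compl_gram pG) /andP[-> a1] /=.
(* The bound 1 obtained for the eigenvalues is sharper than the required 2. *)
by apply: le_lt_trans a1 _; rewrite ltr1n.
Qed.
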